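(* Consider the two-player nonzero-sum stochastic differential game driven by the controlled Markov regime-switching jump-diffusion $Y=Y^{u_1,u_2}$ with $Y(0)=y$, $\alpha(0)=e_i$, as described in the context. Let $\Delta_1,\Delta_2\subseteq\Delta$, where $\Delta=\{\lambda:\Omega\to\mathbb{R}\mid \lambda \text{ is } \mathcal{F}_T\text{-measurable and } E[\lambda]<\infty\}$. For $k=1,2$ and $\lambda_k\in\Delta_k$ put $$J_k^{\lambda_k}(y,e_i,u_1,u_2)=E^{y,e_i}\Big[\int_0^T f_k(t,Y(t),\alpha(t),u_1(t),u_2(t))\,dt+g_k(Y^{u_1,u_2}(T),\alpha(T))+\lambda_k M_k(Y^{u_1,u_2}(T),\alpha(T))\Big].$$ Suppose that for all $\lambda_1\in\Delta_1$, $\lambda_2\in\Delta_2$ there is a Nash equilibrium $(u_1^{*,\lambda_1},u_2^{*,\lambda_2})\in\Theta_1\times\Theta_2$ of the unconstrained game with functionals $J_1^{\lambda_1},J_2^{\lambda_2}$, with values $$\phi_k^{\lambda_k}(y,e_i)=J_k^{\lambda_k}(y,e_i,u_1^{*,\lambda_1},u_2^{*,\lambda_2}),\qquad k=1,2,\ i=1,\dots,D.$$ Suppose moreover that there exist $\lambda_1^0\in\Delta_1$ and $\lambda_2^0\in\Delta_2$ such that, for all $\lambda_1\in\Delta_1$, $\lambda_2\in\Delta_2$, $$M_1\big(Y^{u_1^{*,\lambda_1^0},u_2^{*,\lambda_2}}(T),e_i\big)=0\quad\text{and}\quad M_2\big(Y^{u_1^{*,\lambda_1},u_2^{*,\lambda_2^0}}(T),e_i\big)=0\quad\text{a.s.,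 for all } e_i\in S,\ i=1,\dots,D.$$ Then $(u_1^*,u_2^* )=(u_1^{*,\lambda_1^0},u_2^{*,\lambda_2^0})$ solves the constrained nonzero-sum game (in the sense defined in the context) with functionals $$J_k(y,e_i,u_1,u_2)=E^{y,e_i}\Big[\int_0^T f_k(t,Y(t),\alpha(t),u_1(t),u_2(t))\,dt+g_k(Y^{u_1,u_2}(T),\alpha(T))\Big],\quad k=1,2,$$ and constraints $M_k(Y^{u_1,u_2}(T),\alpha(T))=0$ a.s., $k=1,2$, and its values satisfy $\phi_k(y,e_i)=\phi_k^{\lambda_k^0}(y,e_i)$ for $k=1,2$, $i=1,\dots,D$, where $\phi_k^{\lambda_k^0}$ is the value for the pair of multipliers $(\lambda_1^0,\lambda_2^0)$.
   Context: Probabilistic setting. $T>0$ is finite and $(\Omega,\mathbb{F},(\mathcal{F}_t)_{t\ge0},\mathbb{P})$ is a complete probability space whose right-continuous, $\mathbb{P}$-completed filtration is generated by mutually independent processes: an $M$-dimensional Brownian motion $W$ (this integer $M$ is unrelated to the constraint functions $M_k$), an $L$-dimensional Poisson random measure $N=(N_1,\dots,N_L)$ on $[0,T]\times\mathbb{R}_0$, $\mathbb{R}_0=\mathbb{R}\setminus\{0\}$, and a continuous-time Markov chain $\alpha$ with state space $S=\{e_1,\dots,e_D\}$, the standard basis of $\mathbb{R}^D$, with transition intensities $\mu_{ij}(t)$ ($\mu_{ij}\ge0$ for $i\ne j$, $\sum_j\mu_{ij}=0$). $\tilde N_\alpha=(\tilde N_1,\dots,\tilde N_L)$ denotes the compensated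 Poisson random measures, $\tilde N_l(dt,dz)=N_l(dt,dz)-\nu^l_{\alpha(t-)}(dz)\,dt$, with Lévy measures $\nu^l_{e_i}$ depending on the regime. $\tilde\Phi=(\tilde\Phi_1,\dots,\tilde\Phi_D)^T$, where $\tilde\Phi_j(t)=\Phi_j(t)-\int_0^t\mu_j(s)\,ds$ is a martingale, $\Phi_j(t)$ is the number of jumps of $\alpha$ into $e_j$ up to time $t$, and $\mu_j(s)=\sum_{i\ne j}\mu_{ij}(s)\langle\alpha(s-),e_i\rangle$. State process. For controls $u_1,u_2$, $$dY(t)=b(t,Y(t),\alpha(t),u_1(t),u_2(t))dt+\sigma(t,Y(t),\alpha(t),u_1(t),u_2(t))dW(t)$$ $$+\int_{\mathbb{R}_0}\eta(t,Y(t-),\alpha(t-),u_1(t-),u_2(t-),z)\tilde N_\alpha(dt,dz)+\gamma(t,Y(t-),\alpha(t-),u_1(t-),u_2(t-))d\tilde\Phi(t),$$ $Y(0)=y$, with measurable $b,\sigma,\eta,\gamma$ with values in $\mathbb{R}^N,\mathbb{R}^{N\times M},\mathbb{R}^{N\times L},\mathbb{R}^{N\times D}$ satisfying $\int_0^T\{|b|+|\sigma|^2+\int_{\mathbb{R}_0}|\eta|^2\nu(dz)+\sum_{j=1}^D|\gamma|^2\mu_j(t)\}dt<\infty$ along the solution. The initial value $y$ ranges over $G$, an open subset of $\mathbb{R}^N$ (solvency region). $E^{y,e_i}$ is expectation given $Y(0)=y$, $\alpha(0)=e_i$. Controls. $\mathcal{U}_1,\mathcal{U}_2\subset\mathbb{R}^N$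 are non-empty. $\Theta_1,\Theta_2$ are given families of admissible controls: $u_k$ is $\mathcal{U}_k$-valued, $\mathcal{F}_t$-predictable, càdlàg, $E[\int_0^T|u_k|^2dt]<\infty$, and for every $(u_1,u_2)\in\Theta_1\times\Theta_2$ the state equation has a unique strong solution and $E[\int_0^T|f_k(t,Y(t),\alpha(t),u_1(t),u_2(t))|dt+|g_k(Y(T),\alpha(T))|]<\infty$, $k=1,2$. Here $f_k:[0,T]\times\mathbb{R}^N\times S\times\mathcal{U}_1\times\mathcal{U}_2\to\mathbb{R}$, $g_k:\mathbb{R}^N\times S\to\mathbb{R}$ and $M_k:\mathbb{R}^N\times S\to\mathbb{R}$ are $C^1$ in $y$, and $E[M_k(Y^{u_1,u_2}(T),\alpha(T))]<\infty$. Expectations appearing in the functionals are assumed well defined. Nash equilibrium (unconstrained). $(u_1^*,u_2^* )\in\Theta_1\times\Theta_2$ is a Nash equilibrium for functionals $\mathcal J_1,\mathcal J_2$ if $\mathcal J_1(y,e_i,u_1,u_2^* )\le\mathcal J_1(y,e_i,u_1^*,u_2^* )$ for all $u_1\in\Theta_1$ and $\mathcal J_2(y,e_i,u_1^*,u_2)\le\mathcal J_2(y,e_i,u_1^*,u_2^* )$ for all $u_2\in\Theta_2$, for all $e_i\in S$, $y\in G$. Solution of the constrained game. $(u_1^*,u_2^* )\in\Theta_1\times\Theta_2$ solves the constrained game, with values $\phi_k(y,e_i)$, if it satisfies both constraints and, for all $e_i\in S$, $y\in G$, $$\phi_1(y,e_i)=J_1(y,e_i,u_1^*,u_2^* )=\sup_{u_1}J_1(y,e_i,u_1,u_2^*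 ),\qquad \phi_2(y,e_i)=J_2(y,e_i,u_1^*,u_2^* )=\sup_{u_2}J_2(y,e_i,u_1^*,u_2),$$ where the first supremum is over $u_1\in\Theta_1$ such that $(u_1,u_2^* )$ satisfies the constraint with $k=1$, and the second over $u_2\in\Theta_2$ such that $(u_1^*,u_2)$ satisfies the constraint with $k=2$. *)

(* Defs.v *)
From HB Require Import structures.
From mathcomp Require Import all_boot all_order all_algebra.
From mathcomp Require Import all_classical all_reals all_analysis.
From mathcomp Require Import measurable_realfun.
Import Order.TTheory GRing.Theory Num.Theory numFieldNormedType.Exports.

Set Implicit Arguments.
Unset Strict Implicit.
Unset Printing Implicit Defensive.

Local Open Scope classical_set_scope.
Local Open Scope ring_scope.

(* Conventions.  Time ranges over [R], only the values on [0, T] matter.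
   Vectors of R^N are row vectors.  The state space S = {e_1, ..., e_D} of the
   chain is encoded by ['I_D], the ordinal [i] standing for the basis vector
   e_(i+1). *)

Section Generalities.
Context {R : realType}.

(* |A|^2, the square of the Euclidean (Frobenius) norm; the norm [`|A|] of the
   library is the max norm. *)
Definition sqnorm (m n : nat) (A : 'M[R]_(m, n)) : R :=
  \sum_i \sum_j A i j ^+ 2.

(* Borel measurability of the restriction of [f] to [D], for the trace
   sigma-algebra: [D] itself need not be Borel. *)
Definition borel_on (X Z : topologicalType) (D : set X) (f : X -> Z) :=
  forall O, open O -> exists2 B, <<s [set U : set X | open U] >> B &
    D `&` f @^-1` O = D `&` B.

Definition adapted_to (Omega : Type) (F : set (set Omega))
    (Z : topologicalType) (X : Omega -> Z) :=
  forall O, open O -> F (X @^-1` O).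

Definition C1 (n : nat) (h : 'rV[R]_n -> R) :=
  (forall x, differentiable h x) /\
  (forall v, continuous (fun x => 'd h x v : R)).

Definition cadlag (T : R) (Z : topologicalType) (x : R -> Z) :=
  (forall t, 0 <= t < T -> x s @[s --> t^'+] --> x t) /\
  (forall t, 0 < t <= T -> exists l : Z, x s @[s --> t^'-] --> l).

(* x(t-), with the convention x(0-) = x(0) *)
Definition left_limit (n : nat) (x : R -> 'rV[R]_n) (t : R) : 'rV[R]_n :=
  if 0 < t then lim (x s @[s --> t^'-]) else x t.

(* The same notions for paths in the discrete space ['I_D]. *)
Definition jump_cadlag (D : nat) (T : R) (a : R -> 'I_D) :=
  (forall t, 0 <= t < T -> \forall s \near t^'+, a s = a t) /\
  (forall t, 0 < t <= T -> exists i, \forall s \near t^'-, a s = i).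

Definition jump_left_limit (D : nat) (a : R -> 'I_D) (t : R) : 'I_D :=
  if 0 < t then
    odflt (a t) [pick i | `[< \forall s \near t^'-, a s = i >]]
  else a t.

(* The Poisson probability mass function; unlike [poisson_pmf] it is the
   Dirac mass at 0 when the rate is 0. *)
Definition poisson_mass (rate : R) (k : nat) : R :=
  rate ^+ k / k`!%:R * expR (- rate).

End Generalities.

(* The driving processes: the Brownian motion [W], the random measures [N_l] on
   [0, T] x R_0 (seen as measures on R x R), the chain [alpha], its intensities
   [mu t i j] and the regime-dependent Levy measures [nu l i]. *)
Record noise (R : realType) (d : measure_display) (Omega : measurableType d)
    (M L D : nat) := Noise {
  bm : R -> Omega -> 'rV[R]_M;
  prm : 'I_L -> Omega -> {measure set (R * R) -> \bar R};
  chain : R -> Omega -> 'I_D;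
  intensity : R -> 'I_D -> 'I_D -> R;
  levy : 'I_L -> 'I_D -> {measure set R -> \bar R} }.

Section Noise.
Context {R : realType} {d : measure_display} {Omega : measurableType d}.
Variables (P : probability Omega R) (T : R) (M L D : nat).
Variable X : noise R Omega M L D.
Local Notation leb := (@lebesgue_measure R).

Definition chain_left (t : R) (w : Omega) : 'I_D :=
  jump_left_limit (fun s => chain X s w) t.

Definition bm_events (s : R) : set (set Omega) :=
  [set A | exists r O, [/\ 0 <= r <= T, r <= s, open O & A = bm X r @^-1` O]].

Definition chain_events (s : R) : set (set Omega) :=
  [set A | exists r i,
    [/\ 0 <= r <= T, r <= s & A = [set w | chain X r w = i]]].

Definition prm_events (s : R) : set (set Omega) :=
  [set A | exists l C (B : set (\bar R)), [/\ measurable C, C `<=` [set p | p.1 <= s],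
    measurable B & A = (fun w => prm X l w C) @^-1` B]].

Definition raw_events (s : R) : set (set Omega) :=
  bm_events s `|` chain_events s `|` prm_events s.

Definition filtration (t : R) : set (set Omega) :=
  [set A | forall s, t < s -> <<s raw_events s `|` P.-negligible >> A].

Definition brownian_motion :=
  [/\ forall t m, 0 <= t <= T -> measurable_fun setT (fun w => bm X t w 0 m),
      {ae P, forall w, bm X 0 w = 0},
      forall w, {within `[0%R, T], continuous (fun t => bm X t w)} &
      forall (n : nat) (t : nat -> R) (B : nat -> 'I_M -> set R),
        0 <= t 0%N -> (forall k, (k < n)%N -> t k < t k.+1) -> t n <= T ->
        (forall k m, measurable (B k m)) ->
        P [set w | forall k m, (k < n)%N ->
                     B k m ((bm X (t k.+1) w - bm X (t k) w) 0 m)] =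
        (\prod_(k < n) \prod_(m < M)
           normal_prob 0 (Num.sqrt (t k.+1 - t k)) (B k m))%E].

(* [p s t i j] is the transition function with intensities [mu]: the Kolmogorov
   forward equation in integrated form, so that [mu] need only be integrable. *)
Definition transition_function (p : R -> R -> 'I_D -> 'I_D -> R) :=
  forall s t, 0 <= s -> s <= t -> t <= T -> forall i j,
    [/\ 0 <= p s t i j,
        \sum_k p s t i k = 1,
        forall k, leb.-integrable `[s, t]
          (fun r => (p s r i k * intensity X r k j)%:E) &
        p s t i j = (i == j)%:R +
          \int[leb]_(r in `[s, t]) (\sum_k p s r i k * intensity X r k j)].

Definition markov_chain :=
  [/\ forall t i, 0 <= t <= T -> measurable [set w | chain X t w = i],
      forall w, jump_cadlag T (fun t => chain X t w),
      (forall t i j, 0 <= t <= T -> i != j -> 0 <= intensity X t i j) /\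
      (forall t i, 0 <= t <= T -> \sum_j intensity X t i j = 0),
      forall i j, leb.-integrable `[0%R, T] (fun t => (intensity X t i j)%:E) &
      exists2 p, transition_function p &
        forall (n : nat) (t : nat -> R) (i : nat -> 'I_D),
          0 <= t 0%N -> (forall k, (k < n)%N -> t k <= t k.+1) -> t n <= T ->
          P [set w | forall k, (k <= n)%N -> chain X (t k) w = i k] =
          (P [set w | chain X (t 0%N) w = i 0%N] *
           (\prod_(k < n) p (t k) (t k.+1) (i k) (i k.+1))%:E)%E].

Definition levy_measures :=
  forall l i, levy X l i [set 0] = 0%E /\
    (\int[levy X l i]_z (Num.min 1 (z ^+ 2))%:E < +oo)%E.

(* the measure nu^l_{alpha(s-)}(dz) ds on [0, T] x R_0 *)
Definition prm_compensator (l : 'I_L) (w : Omega) (C : set (R * R)) : \bar R :=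
  (\int[leb]_(s in `[0%R, T]) levy X l (chain_left s w) (xsection C s))%E.

(* N_l is an integer-valued random measure whose compensator is
   nu^l_{alpha(t-)}(dz) dt, hence depends on the chain.  Poisson random measure
   and independence are therefore understood conditionally: given W and alpha,
   the N_l are independent Poisson random measures with intensities
   [prm_compensator l w].  When nu does not depend on the regime, this says
   exactly that the N_l are Poisson random measures, independent of one another
   and of (W, alpha). *)
Definition poisson_random_measures :=
  [/\ forall l C, measurable C -> measurable_fun setT (fun w => prm X l w C),
      forall l w, prm X l w (~` (`[0%R, T] `*` [set~ 0])) = 0%E &
      forall (n : nat) (l : 'I_n -> 'I_L) (C : 'I_n -> set (R * R))
             (m : 'I_n -> nat) (B : set Omega),
        (forall k, measurable (C k)) ->
        (forall k, exists2 e, 0 < e &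
           C k `<=` [set p | 0 <= p.1 <= T /\ e <= `|p.2| ]) ->
        (forall j k, j != k -> l j = l k -> C j `&` C k = set0) ->
        <<s bm_events T `|` chain_events T >> B ->
        P (B `&` [set w | forall k, prm X (l k) w (C k) = (m k)%:R%:E]) =
        (\int[P]_(w in B)
          (\prod_(k < n)
             poisson_mass (fine (prm_compensator (l k) w (C k))) (m k))%:E)%E].

Definition bm_chain_independent :=
  forall A B, <<s bm_events T >> A -> <<s chain_events T >> B ->
    P (A `&` B) = (P A * P B)%E.

(* The last clause makes the expectation given alpha(0) = e_i meaningful. *)
Definition noise_setting :=
  [/\ 0 < T, measure_is_complete P,
      brownian_motion /\ markov_chain,
      [/\ levy_measures, poisson_random_measures & bm_chain_independent] &
      forall i, (0 < P [set w | chain X 0 w = i])%E].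

(* [entry_intensity], [entries] and [comp_entries] are mu_j, Phi_j and
   Phi_j - int mu_j ds. *)
Definition entry_intensity (j : 'I_D) (s : R) (w : Omega) : R :=
  \sum_(i < D | i != j) intensity X s i j * (chain_left s w == i)%:R.

Definition entries (j : 'I_D) (t : R) (w : Omega) : R :=
  fine (counting [set s : R |
    [/\ 0 < s <= t, chain_left s w <> j & chain X s w = j]]).

Definition comp_entries (j : 'I_D) (t : R) (w : Omega) : R :=
  entries j t w - \int[leb]_(s in `[0, t]) entry_intensity j s w.

Definition comp_prm (l : 'I_L) (t : R) (A : set R) (w : Omega) : R :=
  fine (prm X l w (`]0, t] `*` A)) -
  \int[leb]_(s in `[0, t]) fine (levy X l (chain_left s w) A).

(* Stochastic integrals of random fields H(t, w, z), z in a mark space E,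
   against an integrator given by its values [Z t A] on ]0, t] x A, for A in a
   class [marks]; the mark space is [unit] for W and for the compensated jump
   counts. *)

(* the field sum_(k < n) wt_k(w) 1_(]lo_k, hi_k])(t) 1_(mk_k)(z) *)
Record elementary (E : Type) := Elementary {
  nterms : nat;
  lo : nat -> R;
  hi : nat -> R;
  wt : nat -> Omega -> R;
  mk : nat -> set E }.

Definition elementary_predictable (E : Type) (marks : set (set E))
    (S : elementary E) :=
  forall k, (k < nterms S)%N ->
    [/\ 0 <= lo S k, lo S k <= hi S k, hi S k <= T &
        [/\ adapted_to (filtration (lo S k)) (wt S k : Omega -> R),
            (exists c, forall w, `|wt S k w| <= c) &
            marks (mk S k)]].

Definition elementary_value (E : Type) (S : elementary E)
    (t : R) (w : Omega) (z : E) : R :=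
  \sum_(k < nterms S) wt S k w * (lo S k < t <= hi S k)%R%:R * \1_(mk S k) z.

Definition elementary_integral (E : Type) (Z : R -> set E -> Omega -> R)
    (S : elementary E) (t : R) (w : Omega) : R :=
  \sum_(k < nterms S) wt S k w *
    (Z (Num.min (hi S k) t) (mk S k) w - Z (Num.min (lo S k) t) (mk S k) w).

(* [I] is the stochastic integral process of [H] against [Z], whose predictable
   bracket is [q t w dz] dt (given as the functional h |-> int h(z) q(t, w, dz)):
   limit of elementary integrals, uniformly on [0, T], along elementary
   integrands converging to [H] in L^2(q dt).  The usual convergences in
   probability are replaced by almost sure ones, which is equivalent since one
   may pass to a subsequence. *)
Definition stochastic_integral (E : Type) (marks : set (set E))
    (Z : R -> set E -> Omega -> R) (q : R -> Omega -> (E -> \bar R) -> \bar R)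
    (H : R -> Omega -> E -> R) (I : R -> Omega -> R) :=
  exists2 S : nat -> elementary E,
    forall n, elementary_predictable marks (S n) &
    {ae P, forall w,
      ((\int[leb]_(t in `[0%R, T])
          q t w (fun z => ((elementary_value (S n) t w z - H t w z) ^+ 2)%:E))%E
        @[n --> \oo] --> 0%E) /\
      (forall e, 0 < e -> \forall n \near \oo, forall t, 0 <= t <= T ->
         `|elementary_integral Z (S n) t w - I t w| <= e)}.

Definition bm_integral (m : 'I_M) (H I : R -> Omega -> R) :=
  stochastic_integral (E := unit) [set setT]
    (fun t _ w => bm X t w 0 m) (fun _ _ h => h tt)
    (fun t w _ => H t w) I.

Definition entries_integral (j : 'I_D) (H I : R -> Omega -> R) :=
  stochastic_integral (E := unit) [set setT]
    (fun t _ w => comp_entries j t w)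
    (fun t w h => (h tt * (entry_intensity j t w)%:E)%E)
    (fun t w _ => H t w) I.

Definition prm_integral (l : 'I_L) (H : R -> Omega -> R -> R)
    (I : R -> Omega -> R) :=
  stochastic_integral
    [set A : set R | measurable A /\ exists2 e, 0 < e & A `<=` [set z | e <= `|z| ]]
    (comp_prm l)
    (fun t w h => (\int[levy X l (chain_left t w)]_z h z)%E)
    H I.

Definition predictable_rectangles : set (set (R * Omega)) :=
  [set Q | (exists2 A, filtration 0 A & Q = [set 0] `*` A) \/
           (exists s t A, [/\ 0 <= s, s < t, t <= T, filtration s A &
                              Q = `]s, t] `*` A])].

Definition predictable (Z : topologicalType) (u : R -> Omega -> Z) :=
  forall O, open O ->
    <<s `[0%R, T] `*` setT, predictable_rectangles >>
      ((`[0%R, T] `*` setT) `&` [set p | O (u p.1 p.2)]).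

End Noise.

Record coefficients (R : realType) (N M L D : nat) := Coefficients {
  drift : R -> 'rV[R]_N -> 'I_D -> 'rV[R]_N -> 'rV[R]_N -> 'rV[R]_N;
  diffusion : R -> 'rV[R]_N -> 'I_D -> 'rV[R]_N -> 'rV[R]_N -> 'M[R]_(N, M);
  jump : R -> 'rV[R]_N -> 'I_D -> 'rV[R]_N -> 'rV[R]_N -> R -> 'M[R]_(N, L);
  switch : R -> 'rV[R]_N -> 'I_D -> 'rV[R]_N -> 'rV[R]_N -> 'M[R]_(N, D) }.

(* The functions f_k, g_k and M_k of one player. *)
Record payoff (R : realType) (N D : nat) := Payoff {
  running : R -> 'rV[R]_N -> 'I_D -> 'rV[R]_N -> 'rV[R]_N -> R;
  terminal : 'rV[R]_N -> 'I_D -> R;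
  constr : 'rV[R]_N -> 'I_D -> R }.

Section Game.
Context {R : realType} {d : measure_display} {Omega : measurableType d}.
Variables (P : probability Omega R) (T : R) (N M L D : nat).
Variables (X : noise R Omega M L D) (c : coefficients R N M L D).
Local Notation leb := (@lebesgue_measure R).
Local Notation control := (R -> Omega -> 'rV[R]_N).

Definition measurable_coefficients (U1 U2 : set 'rV[R]_N) :=
  forall i,
  let D4 := [set p : R * 'rV[R]_N * 'rV[R]_N * 'rV[R]_N |
              [/\ 0 <= p.1.1.1 <= T, U1 p.1.2 & U2 p.2]] in
  [/\ borel_on D4 (fun p => drift c p.1.1.1 p.1.1.2 i p.1.2 p.2),
      borel_on D4 (fun p => diffusion c p.1.1.1 p.1.1.2 i p.1.2 p.2),
      borel_on [set p : R * 'rV[R]_N * 'rV[R]_N * 'rV[R]_N * R |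
                  D4 p.1 /\ p.2 <> 0]
        (fun p => jump c p.1.1.1.1 p.1.1.1.2 i p.1.1.2 p.1.2 p.2) &
      borel_on D4 (fun p => switch c p.1.1.1 p.1.1.2 i p.1.2 p.2)].

Section StateEquation.
Variables (u1 u2 : control) (y : 'rV[R]_N) (Y : R -> Omega -> 'rV[R]_N).

Definition b_at (t : R) (w : Omega) : 'rV[R]_N :=
  drift c t (Y t w) (chain X t w) (u1 t w) (u2 t w).

Definition sigma_at (t : R) (w : Omega) : 'M[R]_(N, M) :=
  diffusion c t (Y t w) (chain X t w) (u1 t w) (u2 t w).

Definition eta_at (t : R) (w : Omega) (z : R) : 'M[R]_(N, L) :=
  jump c t (left_limit (Y^~ w) t) (chain_left X t w)
    (left_limit (u1^~ w) t) (left_limit (u2^~ w) t) z.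

Definition gamma_at (t : R) (w : Omega) : 'M[R]_(N, D) :=
  switch c t (left_limit (Y^~ w) t) (chain_left X t w)
    (left_limit (u1^~ w) t) (left_limit (u2^~ w) t).

Definition strong_solution :=
  [/\ forall t, 0 <= t <= T -> adapted_to (filtration P T X t) (Y t),
      forall w, cadlag T (Y^~ w),
      {ae P, forall w,
        (\int[leb]_(t in `[0%R, T])
          ((Num.sqrt (sqnorm (b_at t w)))%:E + (sqnorm (sigma_at t w))%:E +
           \sum_(l < L) \int[levy X l (chain_left X t w)]_z
             (sqnorm (col l (eta_at t w z)))%:E +
           \sum_(j < D)
             (sqnorm (gamma_at t w) * entry_intensity X j t w)%:E) < +oo)%E} &
      exists IW IN IPhi,
        [/\ forall n m,
              bm_integral P T X m (fun t w => sigma_at t w n m) (IW n m),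
            forall n l,
              prm_integral P T X l (fun t w z => eta_at t w z n l) (IN n l),
            forall n j,
              entries_integral P T X j (fun t w => gamma_at t w n j) (IPhi n j) &
            {ae P, forall w, forall t, 0 <= t <= T -> forall n,
              Y t w 0 n =
                y 0 n + \int[leb]_(s in `[0, t]) (b_at s w 0 n) +
                \sum_(m < M) (IW n m t w : R) + \sum_(l < L) (IN n l t w : R) +
                \sum_(j < D) (IPhi n j t w : R)}]].

End StateEquation.

Definition unique_strong_solution (u1 u2 : control) (y : 'rV[R]_N)
    (Y : R -> Omega -> 'rV[R]_N) :=
  strong_solution u1 u2 y Y /\
  (forall Y', strong_solution u1 u2 y Y' ->
     {ae P, forall w, forall t, 0 <= t <= T -> Y' t w = Y t w}).

Definition admissible_control (U : set 'rV[R]_N) (u : control) :=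
  [/\ forall t w, 0 <= t <= T -> U (u t w),
      predictable P T X u,
      forall w, cadlag T (u^~ w) &
      (\int[P]_w \int[leb]_(t in `[0%R, T]) (sqnorm (u t w))%:E < +oo)%E].

Definition smooth_payoff (U1 U2 : set 'rV[R]_N) (q : payoff R N D) :=
  [/\ forall t i v1 v2, 0 <= t <= T -> U1 v1 -> U2 v2 ->
        C1 (fun x => running q t x i v1 v2),
      forall i, C1 (fun x => terminal q x i) &
      forall i, C1 (fun x => constr q x i)].

(* The state process Y^{u1, u2} with Y(0) = y is [Y u1 u2 y]. *)
Variable Y : control -> control -> 'rV[R]_N -> R -> Omega -> 'rV[R]_N.

Definition integrable_payoff (q : payoff R N D) (u1 u2 : control)
    (y : 'rV[R]_N) :=
  (leb \x P)%E.-integrable (`[0%R, T] `*` setT)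
    (fun p => (running q p.1 (Y u1 u2 y p.1 p.2) (chain X p.1 p.2)
                 (u1 p.1 p.2) (u2 p.1 p.2))%:E) /\
  P.-integrable setT
    (fun w => (terminal q (Y u1 u2 y T w) (chain X T w))%:E).

(* "E[Z] < oo" does not exclude E[Z] = -oo: only the positive part has to be
   integrable. *)
Definition expectation_ltoo (Z : Omega -> R) :=
  (\int[P]_w (Num.max (Z w) 0)%:E < +oo)%E.

Definition multipliers : set (Omega -> R) :=
  [set lam | adapted_to (filtration P T X T) lam /\ expectation_ltoo lam].

Definition constr_at (q : payoff R N D) (u1 u2 : control) (y : 'rV[R]_N)
    (w : Omega) : R :=
  constr q (Y u1 u2 y T w) (chain X T w).

Definition payoff_at (q : payoff R N D) (u1 u2 : control) (y : 'rV[R]_N)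
    (w : Omega) : R :=
  \int[leb]_(t in `[0%R, T])
    (running q t (Y u1 u2 y t w) (chain X t w) (u1 t w) (u2 t w)) +
  terminal q (Y u1 u2 y T w) (chain X T w).

Definition lagrangian_at (q : payoff R N D) (lam : Omega -> R)
    (u1 u2 : control) (y : 'rV[R]_N) (w : Omega) : R :=
  payoff_at q u1 u2 y w + lam w * constr_at q u1 u2 y w.

Definition starts_at (i : 'I_D) : set Omega := [set w | chain X 0 w = i].

(* E^{y, e_i}[Z]: the elementary conditional expectation given alpha(0) = e_i;
   the initial value y is carried by the random variable Z. *)
Definition expectation_from (i : 'I_D) (Z : Omega -> R) : \bar R :=
  ((fine (P (starts_at i)))^-1%:E * \int[P]_(w in starts_at i) (Z w)%:E)%E.

Definition well_defined_from (i : 'I_D) (Z : Omega -> R) :=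
  (\int[P]_(w in starts_at i) (Num.max (Z w) 0)%:E < +oo)%E \/
  (\int[P]_(w in starts_at i) (Num.max (- Z w) 0)%:E < +oo)%E.

Definition J (q : payoff R N D) (y : 'rV[R]_N) (i : 'I_D)
    (u1 u2 : control) : \bar R :=
  expectation_from i (payoff_at q u1 u2 y).

Definition Jlam (q : payoff R N D) (lam : Omega -> R) (y : 'rV[R]_N) (i : 'I_D)
    (u1 u2 : control) : \bar R :=
  expectation_from i (lagrangian_at q lam u1 u2 y).

Variables (G : set 'rV[R]_N) (U1 U2 : set 'rV[R]_N).
Variables (Theta1 Theta2 : set control).

Definition admissible_families (q1 q2 : payoff R N D) :=
  [/\ forall u1, Theta1 u1 -> admissible_control U1 u1,
      forall u2, Theta2 u2 -> admissible_control U2 u2 &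
      forall u1 u2 y, Theta1 u1 -> Theta2 u2 -> G y ->
        [/\ unique_strong_solution u1 u2 y (Y u1 u2 y),
            integrable_payoff q1 u1 u2 y,
            integrable_payoff q2 u1 u2 y,
            expectation_ltoo (constr_at q1 u1 u2 y) &
            expectation_ltoo (constr_at q2 u1 u2 y)]].

Definition game_setting (q1 q2 : payoff R N D) :=
  [/\ noise_setting P T X, measurable_coefficients U1 U2, open G,
      U1 !=set0 /\ U2 !=set0 &
      [/\ smooth_payoff U1 U2 q1, smooth_payoff U1 U2 q2 &
          admissible_families q1 q2]].

Definition well_defined_functionals (q : payoff R N D)
    (Delta : set (Omega -> R)) :=
  forall lam u1 u2 y i, Delta lam -> Theta1 u1 -> Theta2 u2 -> G y ->
    well_defined_from i (lagrangian_at q lam u1 u2 y).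

Definition nash_equilibrium
    (J1 J2 : 'rV[R]_N -> 'I_D -> control -> control -> \bar R)
    (u1 u2 : control) :=
  [/\ Theta1 u1, Theta2 u2 &
      forall y i, G y ->
        (forall v1, Theta1 v1 -> (J1 y i v1 u2 <= J1 y i u1 u2)%E) /\
        (forall v2, Theta2 v2 -> (J2 y i u1 v2 <= J2 y i u1 u2)%E)].

(* M(Y(T), alpha(T)) = 0 almost surely given alpha(0) = e_i *)
Definition satisfies_constraint (q : payoff R N D) (y : 'rV[R]_N) (i : 'I_D)
    (u1 u2 : control) :=
  {ae P, forall w, starts_at i w -> constr_at q u1 u2 y w = 0}.

Definition solves_constrained_game (q1 q2 : payoff R N D) (u1 u2 : control)
    (phi1 phi2 : 'rV[R]_N -> 'I_D -> \bar R) :=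
  [/\ Theta1 u1, Theta2 u2 &
      forall y i, G y ->
        [/\ satisfies_constraint q1 y i u1 u2,
            satisfies_constraint q2 y i u1 u2,
            phi1 y i = J q1 y i u1 u2 /\
            J q1 y i u1 u2 =
              ereal_sup [set J q1 y i v1 u2 | v1 in
                [set v1 | Theta1 v1 /\ satisfies_constraint q1 y i v1 u2]] &
            phi2 y i = J q2 y i u1 u2 /\
            J q2 y i u1 u2 =
              ereal_sup [set J q2 y i u1 v2 | v2 in
                [set v2 | Theta2 v2 /\ satisfies_constraint q2 y i u1 v2]]]].

End Game.

(* Main.v *)
(* Almost surely zero constraints kill the multiplier term, so on constrained
   controls the Lagrangian functionals and the original ones coincide; since
   the Nash equilibrium for the optimal multipliers satisfies the constraints
   and is optimal among all deviations, it is optimal among the constrained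
   ones. *)
Require Import Defs.
From mathcomp Require Import all_boot all_order all_algebra.
From mathcomp Require Import all_classical all_reals all_analysis.
From mathcomp Require Import measurable_realfun.
Import Order.TTheory GRing.Theory Num.Theory.

Set Implicit Arguments.
Unset Strict Implicit.
Unset Printing Implicit Defensive.

Local Open Scope classical_set_scope.
Local Open Scope ring_scope.


Section AeEqIntegral.
Local Open Scope ereal_scope.
Context {d : measure_display} {Omega : measurableType d} {R : realType}.
Variable mu : {measure set Omega -> \bar R}.
Implicit Types (D : set Omega) (f g : Omega -> \bar R).

Import HBNNSimple.

Lemma sintegral_restrict_null (A : set Omega) (h : {nnsfun Omega >-> R}) :
  measurable A -> mu A = 0 -> sintegral mu (h \_ (~` A)) = sintegral mu h.
Proof.
move=> mA A0; rewrite -integral_nnsfun; last exact: measurableC.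
rewrite -[in RHS](patch_setT (cst 0%R) h) -integral_nnsfun//.
rewrite [RHS](ge0_negligible_integral mA measurableT)//; first by rewrite setTD.
  exact/measurable_EFinP.
by move=> x _; rewrite lee_fin.
Qed.

(** A simple function below [f] on [D], set to 0 on a measurable null set containing the points of
    [D] where [f] and [g] differ, lies below [g] on [D] and keeps its integral. *)
Lemma ge0_le_integral_ae_eq D f g :
  (forall x, 0 <= f x) -> (forall x, 0 <= g x) ->
  {ae mu, forall x, D x -> f x = g x} ->
  \int[mu]_(x in D) f x <= \int[mu]_(x in D) g x.
Proof.
move=> f0 g0 [A [mA A0 fgA]].
rewrite !ge0_integralE//; apply: ge_ereal_sup => _ [h /= hf <-].
apply: ereal_sup_ubound; exists (proj_nnsfun h (measurableC mA)) => [x|] /=.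
  rewrite mindicE; have [xA|xA] := boolP (x \in ~` A); last first.
    by rewrite mulr0 /patch; case: ifP.
  rewrite mulr1; apply: (le_trans (hf x)).
  rewrite /patch; case: ifPn => // /set_mem Dx.
  (* A point of [D] where [f] and [g] differ would belong to [A], which is excluded here. *)
  have [->//|fg] := eqVneq (f x) (g x).
  by move/set_mem: xA; case; apply: fgA => /(_ Dx)/eqP; apply/negP.
by rewrite -mrestrict sintegral_restrict_null.
Qed.

(* Unlike [ae_eq_integral], this needs no measurability: the integral of a
   nonnegative function is a supremum over simple functions, and these can be
   set to 0 on a null set. *)
Lemma ae_eq_integral_nonmeasurable D f g :
  {ae mu, forall x, D x -> f x = g x} ->
  \int[mu]_(x in D) f x = \int[mu]_(x in D) g x.
Proof.
move=> fg; rewrite integralE [RHS]integralE.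
(* Positive and negative parts are treated separately; the hypothesis is symmetric in [f] and [g],
   so each equality follows from two inequalities. *)
by congr (_ - _); apply/eqP; rewrite eq_le; apply/andP; split;
  apply: ge0_le_integral_ae_eq => //; apply: filterS fg => x fgx Dx;
  rewrite ?funeposE ?funenegE fgx.
Qed.

End AeEqIntegral.

Section Constraint.
Context {R : realType} {d : measure_display} {Omega : measurableType d}.
Context {P : probability Omega R} {T : R} {N M L D : nat}.
Context {X : noise R Omega M L D}.
Context {Y : (R -> Omega -> 'rV[R]_N) -> (R -> Omega -> 'rV[R]_N) ->
  'rV[R]_N -> R -> Omega -> 'rV[R]_N}.

Lemma Jlam_satisfies_constraint (q : payoff R N D) (lam : Omega -> R)
    (y : 'rV[R]_N) (i : 'I_D) (u1 u2 : R -> Omega -> 'rV[R]_N) :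
  satisfies_constraint P T X Y q y i u1 u2 ->
  Jlam P T X Y q lam y i u1 u2 = J P T X Y q y i u1 u2.
Proof.
move=> sat; rewrite /Jlam /J /expectation_from; congr (_ * _)%E.
apply: ae_eq_integral_nonmeasurable; apply: filterS sat => w sat_w /sat_w cw.
by rewrite /lagrangian_at cw mulr0 addr0.
Qed.

(* The regimes are finitely many, so the constraint may be evaluated at the
   random regime alpha(T). *)
Lemma satisfies_constraint_all_regimes (q : payoff R N D) (y : 'rV[R]_N)
    (i : 'I_D) (u1 u2 : R -> Omega -> 'rV[R]_N) :
  (forall j, {ae P, forall w, constr q (Y u1 u2 y T w) j = 0}) ->
  satisfies_constraint P T X Y q y i u1 u2.
Proof.
move=> cq0.
have : {ae P, forall w j, constr q (Y u1 u2 y T w) j = 0}.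
  exact: filter_forall.
by apply: filterS => w cw _; exact: cw.
Qed.

End Constraint.

Lemma ereal_sup_eq_max {R : realType} {I : Type} (A : set I)
    (F : I -> \bar R) (a : I) :
  A a -> (forall b, A b -> (F b <= F a)%E) -> F a = ereal_sup [set F b | b in A].
Proof.
move=> Aa Fa; apply/eqP; rewrite eq_le ereal_sup_ubound/=; last by exists a.
by apply: ge_ereal_sup => _ [b Ab <-]; exact: Fa.
Qed.

Theorem theorem4p2 (R : realType) (d : measure_display)
    (Omega : measurableType d) (P : probability Omega R) (T : R)
    (N M L D : nat)
    (X : noise R Omega M L D) (c : coefficients R N M L D)
    (q1 q2 : payoff R N D)
    (Y : (R -> Omega -> 'rV[R]_N) -> (R -> Omega -> 'rV[R]_N) -> 'rV[R]_N ->
         R -> Omega -> 'rV[R]_N)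
    (G U1 U2 : set 'rV[R]_N)
    (Theta1 Theta2 : set (R -> Omega -> 'rV[R]_N))
    (Delta1 Delta2 : set (Omega -> R))
    (ustar1 ustar2 : (Omega -> R) -> (Omega -> R) -> R -> Omega -> 'rV[R]_N)
    (lam01 lam02 : Omega -> R)
    (setting : game_setting P T X c Y G U1 U2 Theta1 Theta2 q1 q2)
    (subDelta1 : Delta1 `<=` multipliers P T X)
    (subDelta2 : Delta2 `<=` multipliers P T X)
    (well_defined1 : well_defined_functionals P T X Y G Theta1 Theta2 q1 Delta1)
    (well_defined2 : well_defined_functionals P T X Y G Theta1 Theta2 q2 Delta2)
    (nash : forall lam1 lam2, Delta1 lam1 -> Delta2 lam2 ->
       nash_equilibrium G Theta1 Theta2 (Jlam P T X Y q1 lam1)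
         (Jlam P T X Y q2 lam2) (ustar1 lam1 lam2) (ustar2 lam1 lam2))
    (Dlam01 : Delta1 lam01) (Dlam02 : Delta2 lam02)
    (vanish : forall lam1 lam2, Delta1 lam1 -> Delta2 lam2 ->
       forall y i, G y ->
         {ae P, forall w,
           constr q1 (Y (ustar1 lam01 lam2) (ustar2 lam01 lam2) y T w) i = 0} /\
         {ae P, forall w,
           constr q2 (Y (ustar1 lam1 lam02) (ustar2 lam1 lam02) y T w) i = 0}) :
  exists phi1 phi2 : 'rV[R]_N -> 'I_D -> \bar R,
    solves_constrained_game P T X Y G Theta1 Theta2 q1 q2
      (ustar1 lam01 lam02) (ustar2 lam01 lam02) phi1 phi2 /\
    forall y i, G y ->
      phi1 y i = Jlam P T X Y q1 lam01 y i
                   (ustar1 lam01 lam02) (ustar2 lam01 lam02) /\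
      phi2 y i = Jlam P T X Y q2 lam02 y i
                   (ustar1 lam01 lam02) (ustar2 lam01 lam02).
Proof.
(* From here on everything is taken at the single pair of multipliers ([lam01], [lam02]), where the
   two families of vanishing conditions meet. *)
have [Th1 Th2 opt] := nash _ _ Dlam01 Dlam02.
have sat1 y i : G y -> satisfies_constraint P T X Y q1 y i
    (ustar1 lam01 lam02) (ustar2 lam01 lam02).
  move=> Gy; apply: satisfies_constraint_all_regimes => j.
  by have [] := vanish _ _ Dlam01 Dlam02 y j Gy.
have sat2 y i : G y -> satisfies_constraint P T X Y q2 y i
    (ustar1 lam01 lam02) (ustar2 lam01 lam02).
  move=> Gy; apply: satisfies_constraint_all_regimes => j.
  by have [] := vanish _ _ Dlam01 Dlam02 y j Gy.
exists (fun y i => J P T X Y q1 y i (ustar1 lam01 lam02) (ustar2 lam01 lam02)).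
exists (fun y i => J P T X Y q2 y i (ustar1 lam01 lam02) (ustar2 lam01 lam02)).
split; last first.
  move=> y i Gy; split.
    by rewrite (Jlam_satisfies_constraint _ (sat1 y i Gy)).
  by rewrite (Jlam_satisfies_constraint _ (sat2 y i Gy)).
split=> // y i Gy; have [opt1 opt2] := opt y i Gy.
split; [exact: sat1|exact: sat2|split=> //|split=> //].
- apply: (ereal_sup_eq_max (F := fun v => J P T X Y q1 y i v _)).
    by split=> //; exact: sat1.
  move=> v [Thv satv].
  (* Both [v] and the equilibrium control satisfy the first constraint against the same opponent, so
     both payoffs turn into Lagrangian functionals with multiplier [lam01], which the Nash
     inequality compares. *)
  rewrite -(Jlam_satisfies_constraint lam01 satv).
  by rewrite -(Jlam_satisfies_constraint lam01 (sat1 y i Gy)); exact: opt1.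
- apply: (ereal_sup_eq_max (F := fun v => J P T X Y q2 y i _ v)).
    by split=> //; exact: sat2.
  move=> v [Thv satv].
  rewrite -(Jlam_satisfies_constraint lam02 satv).
  by rewrite -(Jlam_satisfies_constraint lam02 (sat2 y i Gy)); exact: opt2.
Qed.
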